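(* Let $s\ge 2$ be an integer and let $\Sigma\subset CAT(\Lambda_s^{\mathbb N})$ be a maximal commutative semigroup. Then $\langle\Sigma,\sigma^{-1}\rangle$ is maximal commutative in $CAT(\Lambda_s^{\mathbb Z})$.
   Context: $\mathbb N$ includes $0$. $\Lambda_s=\{0,1,\dots,s-1\}$ is the symbol set (discrete topology); $\Lambda_s^{\mathbb N}$ and $\Lambda_s^{\mathbb Z}$ are the spaces of one-sided and two-sided sequences, with the product topology. On both, $\sigma$ is the left shift, $\sigma(a)_k=a_{k+1}$. For $\Omega=\Lambda_s^{\mathbb N}$ or $\Lambda_s^{\mathbb Z}$, $CAT(\Omega)$ is the semigroup (under composition) of all continuous maps $\tau:\Omega\to\Omega$ with $\tau\sigma=\sigma\tau$. Embedding of $CAT(\Lambda_s^{\mathbb N})$ in $CAT(\Lambda_s^{\mathbb Z})$: every $\tau\in CAT(\Lambda_s^{\mathbb N})$ is given by a block map $f_\tau:\Lambda_s^{r+1}\to\Lambda_s$ for some $r\in\mathbb N$, via $\tau(a)_k=f_\tau(a_k a_{k+1}\dots a_{k+r})$ for all $k$; the same formula for all $k\in\mathbb Z$ defines an element of $CAT(\Lambda_s^{\mathbb Z})$. Under this correspondence $CAT(\Lambda_s^{\mathbb N})$ is regarded as a subset of $CAT(\Lambda_s^{\mathbb Z})$, and a semigroup $\Sigma\subset CAT(\Lambda_s^{\mathbb N})$ as a semigroup in $CAT(\Lambda_s^{\mathbb Z})$. $\langle\Sigma,\tau\rangle$ denotes the semigroup generated under composition by $\tau$ and all elements of $\Sigma$.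 A semigroup $\Sigma\subset CAT(\Omega)$ is maximal commutative (MC) in $CAT(\Omega)$ if (1) $\Sigma$ is commutative, and (2) every $\mu\in CAT(\Omega)$ with $\mu\tau=\tau\mu$ for all $\tau\in\Sigma$ belongs to $\Sigma$. *)

(* Defs.v *)
From mathcomp Require Import all_boot all_order all_algebra.
From mathcomp Require Import all_classical topology.

Set Implicit Arguments.
Unset Strict Implicit.
Unset Printing Implicit Defensive.

Import GRing.Theory.
Local Open Scope classical_set_scope.
Local Open Scope ring_scope.

(* One-sided sequences are [config nat s], two-sided ones [config int s].
   The alias [discrete_topology] is what gives ['I_s] its topology. *)
Notation config I s := {ptws I -> discrete_topology 'I_s}.

Definition shift (I : pzSemiRingType) (s : nat) (a : config I s) :
  config I s := fun k => a (k + 1).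

Definition shift_inv (s : nat) (a : config int s) : config int s :=
  fun k => a (k - 1).

Lemma shiftK (s : nat) : cancel (@shift int s) (@shift_inv s).
Proof. by move=> a; apply/funext => k; rewrite /shift_inv /shift subrK. Qed.

Lemma shift_invK (s : nat) : cancel (@shift_inv s) (@shift int s).
Proof. by move=> a; apply/funext => k; rewrite /shift_inv /shift addrK. Qed.

Definition CAT (I : pzSemiRingType) (s : nat) :
    set (config I s -> config I s) :=
  [set tau | continuous tau /\ tau \o @shift I s = @shift I s \o tau].

Definition composition_closed (X : Type) (S : set (X -> X)) : Prop :=
  forall tau mu, S tau -> S mu -> S (tau \o mu).

Definition generated_semigroup (X : Type) (G : set (X -> X)) : set (X -> X) :=
  smallest (@composition_closed X) G.

Record maximal_commutative (I : pzSemiRingType) (s : nat)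
    (S : set (config I s -> config I s)) : Prop := MaximalCommutative {
  mc_sub_CAT : S `<=` CAT (I := I) (s := s);
  mc_semigroup : composition_closed S;
  mc_commutative : forall tau mu, S tau -> S mu -> tau \o mu = mu \o tau;
  mc_maximal : forall mu, CAT mu ->
    (forall tau, S tau -> mu \o tau = tau \o mu) -> S mu }.

(* The map with block map [f]; on [nat] the index [k + i%:R] is [k + i]. *)
Definition of_block_map (I : pzSemiRingType) (s r : nat)
    (f : r.+1.-tuple 'I_s -> 'I_s) (a : config I s) : config I s :=
  fun k => f [tuple a (k + i%:R) | i < r.+1].

(* A map in [CAT (I := nat)] has block maps with arbitrarily large [r]; they
   all induce the same two-sided map. *)
Definition two_sided (s : nat) (S : set (config nat s -> config nat s)) :
    set (config int s -> config int s) :=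
  [set T | exists r (f : r.+1.-tuple 'I_s -> 'I_s),
     S (of_block_map f) /\ T = of_block_map f].

(* Main.v *)
(* A two-sided cellular automaton is determined by its coordinate 0, hence by
   its restriction to nonnegative coordinates.  Therefore two block maps commute
   on one-sided sequences if and only if they commute on two-sided ones.  By
   compactness every map mu commuting with <Sigma, sigma^-1> has finite memory,
   so sigma^m mu is given by a block map for m large; its one-sided version
   commutes with Sigma, hence belongs to Sigma, and mu = sigma^-m (sigma^m mu)
   is in the generated semigroup. *)
Require Import Defs.
From mathcomp Require Import all_boot all_order all_algebra.
From mathcomp Require Import all_classical topology.
From mathcomp Require Import zify.
Set Implicit Arguments.
Unset Strict Implicit.
Unset Printing Implicit Defensive.

Import GRing.Theory.
Local Open Scope classical_set_scope.
Local Open Scope ring_scope.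

(** * Product topology, compactness and block maps over a general index semiring *)

Section Config.
Variables (I : pzSemiRingType) (s : nat).
Implicit Types (a b : config I s) (D : seq I).

Definition cylinder a D : set (config I s) :=
  [set b : config I s | {in D, b =1 a}].

Lemma cylinder_filter a : Filter (filter_from [set: seq I] (cylinder a)).
Proof.
apply: filter_fromT_filter; first by exists [::].
move=> D E; exists (D ++ E) => b bDE; split=> k kD;
  by apply: bDE; rewrite mem_cat kD ?orbT.
Qed.

(** The product topology is the supremum of the topologies induced by the coordinates, and every
    symbol is isolated in the discrete alphabet. *)
Lemma cvg_configP (F : set_system (config I s)) a : Filter F ->
  F --> a <-> forall k, F [set b | b k = a k].
Proof.
move=> FF; split=> [Fa k|Fa].
  have := @proj_continuous I (fun=> discrete_topology 'I_s) k a.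
  move=> /(_ [set a k]) /= ak; apply: Fa; apply: ak.
  by rewrite nbhs_principalE; apply/principal_filterP.
apply/cvg_sup => k A [_ [[B _ <-] Bak] sBA].
by apply: filterS (Fa k) => b /= bk; apply: sBA; rewrite /= bk.
Qed.

(** The filter of cylinders converges to [a] coordinatewise, so it contains all neighbourhoods;
    conversely a cylinder is a finite intersection of one-coordinate neighbourhoods. *)
Lemma nbhs_configE a : nbhs a = filter_from [set: seq I] (cylinder a).
Proof.
apply/seteqP; split=> [|A [D _ DA]].
  have FF := cylinder_filter a.
  by apply/cvg_configP => k; exists [:: k] => // b; apply; rewrite inE.
have Fa : Filter (nbhs a) := nbhs_filter a.
apply: filterS DA _; elim: D => [|k D IHD]; first by apply: filterS filterT.
have ak : nbhs a [set b | b k = a k] by apply: ((cvg_configP a Fa).1 _ k).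
by apply: filterS2 ak IHD => b bk bD j; rewrite inE => /predU1P[->|/bD].
Qed.

Lemma config_compact : compact [set: config I s].
Proof.
have fin : finite_set [set: discrete_topology 'I_s].
  exact: (@finite_finset 'I_s).
have := @tychonoff I (fun=> discrete_topology 'I_s) (fun=> setT)
  (fun=> finite_compact fin).
by congr compact; apply/seteqP; split.
Qed.

Lemma finite_memory (T : Type) (g : config I s -> T) :
    (forall a, nbhs a [set b | g b = g a]) ->
  exists D, forall a b, {in D, b =1 a} -> g b = g a.
Proof.
move=> g_loc.
(* The near-covering property, along the filter of large finite windows, yields
   a single window valid for all configurations. *)
pose F := filter_from [set: seq I] (fun D => [set E : seq I | {subset D <= E}]).
have FF : Filter F.
  apply: filter_fromT_filter; first by exists [::].
  move=> D E; exists (D ++ E) => X DEX; split=> k kD;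
    by apply: DEX; rewrite mem_cat kD ?orbT.
have /compact_near_coveringP cover := config_compact.
have [|D _ /(_ D)] := cover _ F
    (fun D a => forall b, {in D, b =1 a} -> g b = g a) FF.
  move=> a _; have := g_loc a; rewrite nbhs_configE => -[D _ DA].
  exists (cylinder a D, [set E | {subset D <= E}]).
    by split=> /=; [rewrite nbhs_configE|]; exists D.
  move=> [b E] /= [ba DE] c cb; rewrite (DA b ba); apply: DA => k kD.
  by rewrite cb ?ba //; exact: DE.
by move=> P; exists D => a b ab; apply: P.
Qed.

Lemma continuous_configP (tau : config I s -> config I s) :
  continuous tau <-> forall a k, nbhs a [set b | tau b k = tau a k].
Proof.
split=> [tau_cont a|tau_loc a].
  have FF : Filter (tau @ a) := fmap_filter _ (nbhs_filter a).
  by move=> k; exact: ((cvg_configP _ FF).1 (tau_cont a) k).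
have FF : Filter (tau @ a) := fmap_filter _ (nbhs_filter a).
exact: ((cvg_configP _ FF).2 (tau_loc a)).
Qed.

Lemma CAT_comp (tau mu : config I s -> config I s) :
  CAT tau -> CAT mu -> CAT (tau \o mu).
Proof.
move=> [tau_cont tau_shift] [mu_cont mu_shift]; split.
  by move=> a; apply: continuous_comp; [exact: mu_cont|exact: tau_cont].
by rewrite -compA mu_shift compA tau_shift.
Qed.

Lemma CAT_of_block_map r (f : r.+1.-tuple 'I_s -> 'I_s) :
  CAT (of_block_map f : config I s -> config I s).
Proof.
split.
  apply/continuous_configP => a k; rewrite nbhs_configE.
  exists [seq k + i%:R | i <- iota 0 r.+1] => // b ab.
  congr f; apply: eq_from_tnth => i; rewrite !tnth_mktuple ab //.
  by apply/mapP; exists (val i); rewrite ?mem_iota ?ltn_ord.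
apply/funext => a; apply/funext => k; congr f.
by apply: eq_from_tnth => i; rewrite !tnth_mktuple addrAC.
Qed.

Lemma iter_shift m a k : iter m (@shift I s) a k = a (k + m%:R).
Proof.
elim: m k => [|m IHm] k; first by rewrite addr0.
by rewrite iterS /shift IHm -addrA nat1r.
Qed.

Lemma CAT_iter_shift (tau : config I s -> config I s) m a :
  CAT tau -> tau (iter m (@shift I s) a) = iter m (@shift I s) (tau a).
Proof.
move=> [_ /funeqP tau_shift]; elim: m => //= m <-.
exact: tau_shift (iter m _ a).
Qed.

Lemma CAT_natr (tau : config I s -> config I s) m a :
  CAT tau -> tau a m%:R = tau (iter m (@shift I s) a) 0.
Proof. by move=> tauC; rewrite CAT_iter_shift// iter_shift add0r. Qed.

(** The left inverse [e] of the canonical map from [nat] lets one construction serve both index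
    sets: [id] for [nat], [absz] for [int]. *)
Lemma block_map_of_memory (e : I -> nat) r (g : config I s -> 'I_s) :
    (forall i : nat, e i%:R = i) ->
    (forall a b, (forall i, (i <= r)%N -> b i%:R = a i%:R) -> g b = g a) ->
  exists f : r.+1.-tuple 'I_s -> 'I_s, forall a, g a = of_block_map f a 0.
Proof.
move=> eK g_mem.
(* The word [t] is extended to a full configuration before [g] is applied. The default [thead t]
   avoids choosing a symbol of ['I_s]; values outside the window do not affect [g]. *)
exists (fun t => g (fun k => nth (thead t) t (e k))) => a.
apply/esym/g_mem => i ir; rewrite eK.
have -> : i = Ordinal (ir : (i < r.+1)%N) by [].
by rewrite -tnth_nth tnth_mktuple add0r.
Qed.

End Config.

(** * One-sided automata are block maps *)

Section OneSided.
Variable s : nat.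

Lemma CAT_nat_ext (tau mu : config nat s -> config nat s) :
  CAT tau -> CAT mu -> (forall a, tau a 0 = mu a 0) -> tau = mu.
Proof.
move=> tauC muC tau_mu; apply/funext => a; apply/funext => k.
by rewrite -(natn k) !CAT_natr.
Qed.

Lemma CAT_nat_block_map (tau : config nat s -> config nat s) :
  CAT tau -> exists r (f : r.+1.-tuple 'I_s -> 'I_s), tau = of_block_map f.
Proof.
move=> tauC; have [/continuous_configP tau_loc _] := tauC.
have [D D_mem] := finite_memory (fun a => tau_loc a 0).
pose r := (\max_(k <- D) k)%N.
have [|a b ab|f fE] := @block_map_of_memory nat s id r (fun a => tau a 0).
- exact: natn.
- apply: D_mem => k kD; rewrite -(natn k); apply: ab.
  exact: (@leq_bigmax_seq _ _ predT id).
exists r, f; apply: CAT_nat_ext => //; exact: CAT_of_block_map.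
Qed.

End OneSided.

(** * Two-sided automata and their comparison with one-sided ones *)

Section TwoSided.
Variable s : nat.

Lemma CAT_shift : CAT (@shift int s).
Proof.
split=> //; apply/continuous_configP => a k; rewrite nbhs_configE.
by exists [:: k + 1] => // b; apply; rewrite inE.
Qed.

Lemma CAT_shift_inv : CAT (I := int) (@shift_inv s).
Proof.
split; last by apply/funext => a /=; rewrite shiftK shift_invK.
apply/continuous_configP => a k; rewrite nbhs_configE.
by exists [:: k - 1] => // b; apply; rewrite inE.
Qed.

Lemma CAT_int_shift_inv (tau : config int s -> config int s) :
  CAT tau -> tau \o @shift_inv s = @shift_inv s \o tau.
Proof.
move=> [_ /funeqP tau_shift]; apply/funext => a /=.
by rewrite -{2}(shift_invK a) [tau (shift _)]tau_shift /= shiftK.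
Qed.

Lemma CAT_int_ext (tau mu : config int s -> config int s) :
  CAT tau -> CAT mu -> (forall a, tau a 0 = mu a 0) -> tau = mu.
Proof.
move=> tauC muC tau_mu; apply/funext => a; apply/funext => k.
have /funeqP tauV := CAT_int_shift_inv tauC.
have /funeqP muV := CAT_int_shift_inv muC.
(* Nonnegative coordinates are shifted to 0 directly; negative ones are reached one step at a time
   through [shift_inv], which is why [a] is generalized. *)
elim: k a => [|n _|n IHn] a; first exact: tau_mu.
  by rewrite -natz !CAT_natr.
have -> : - n.+1%:Z = - n%:Z - 1 by rewrite -addn1 PoszD opprD.
by have := IHn (shift_inv a); move: (tauV a) (muV a) => /= -> ->.
Qed.

Lemma CAT_int_block_map (tau : config int s -> config int s) :
  CAT tau -> exists m r (f : r.+1.-tuple 'I_s -> 'I_s),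
    iter m (@shift int s) \o tau = of_block_map f.
Proof.
move=> tauC; have [/continuous_configP tau_loc _] := tauC.
have [D D_mem] := finite_memory (fun a => tau_loc a 0).
(* The memory [D] lies in the window from [-m] to [m]; applying the shift [m] times moves it to the
   window from 0 to [m + m]. *)
pose m := (\max_(k <- D) `|k|)%N; exists m.
have mtauC : CAT (iter m (@shift int s) \o tau).
  elim: m => [|m IHm]; [exact: tauC|exact: CAT_comp CAT_shift IHm].
have [|a b ab|f fE] := @block_map_of_memory int s absz (m + m)
    (fun a => iter m (@shift int s) (tau a) 0).
- by move=> i; rewrite natz.
- rewrite -!(CAT_iter_shift m _ tauC); apply: D_mem => k kD.
  rewrite !iter_shift.
  have kM : (`|k| <= m)%N by exact: leq_bigmax_seq.
  have -> : k + m%:R = (`|(k + m%:Z)%R|%N)%:R by rewrite !natz; lia.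
  apply: ab; lia.
exists (m + m)%N, f; apply: CAT_int_ext => //; exact: CAT_of_block_map.
Qed.

Definition restrict (a : config int s) : config nat s := fun k => a k%:R.

Lemma restrict_surj b : exists a, restrict a = b.
Proof.
(* Reflection at 0 fills the negative coordinates without requiring a default symbol. *)
by exists (fun k => b `|k|%N); apply/funext => k; rewrite /restrict natz.
Qed.

Lemma restrict_block_map r (f : r.+1.-tuple 'I_s -> 'I_s) a :
  restrict (of_block_map f a) = of_block_map f (restrict a).
Proof.
apply/funext => k; congr f; apply: eq_from_tnth => i.
by rewrite !tnth_mktuple /restrict natrD natn.
Qed.

(** By [restrict_block_map], [restrict] intertwines the two versions of a block map. It keeps
    coordinate 0, which determines a two-sided automaton, and it is surjective, which gives the
    converse. *)
Lemma block_map_comm r q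
    (f : r.+1.-tuple 'I_s -> 'I_s) (g : q.+1.-tuple 'I_s -> 'I_s) :
  (of_block_map f : config nat s -> _) \o of_block_map g =
    of_block_map g \o of_block_map f <->
  (of_block_map f : config int s -> _) \o of_block_map g =
    of_block_map g \o of_block_map f.
Proof.
split=> /funeqP fg.
  apply: CAT_int_ext; try by apply: CAT_comp; exact: CAT_of_block_map.
  move=> a; have := congr1 (fun c : config nat s => c 0) (fg (restrict a)).
  by rewrite /= -!restrict_block_map.
apply/funext => b; have [a <-] := restrict_surj b.
by move: (fg a) => /=; rewrite -!restrict_block_map => ->.
Qed.

End TwoSided.

(** * Generated semigroups and maximality *)

Lemma generated_semigroup_commute (X : Type) (G : set (X -> X)) :
    (forall tau mu, G tau -> G mu -> tau \o mu = mu \o tau) ->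
  forall tau mu, generated_semigroup G tau -> generated_semigroup G mu ->
    tau \o mu = mu \o tau.
Proof.
move=> Gcomm.
have centralizer (H : set (X -> X)) :
    (forall tau mu, G tau -> H mu -> tau \o mu = mu \o tau) ->
    forall tau mu, generated_semigroup G tau -> H mu -> tau \o mu = mu \o tau.
  move=> GH tau mu Gtau Hmu.
  (* The centralizer of a single map is closed under composition. *)
  suff : generated_semigroup G `<=` [set nu : X -> X | nu \o mu = mu \o nu].
    by apply.
  apply: smallest_sub.
    by move=> tau1 tau2 /= tau1mu tau2mu; rewrite -compA tau2mu compA tau1mu.
  by move=> nu Gnu; apply: GH.
(* The centralizer argument is used twice: here with [H] the generated semigroup, then with [H]
   equal to [G] and the two factors exchanged. *)
apply: (centralizer) => tau mu Gtau Gmu.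
by apply/esym; apply: centralizer Gmu Gtau => ? ? *; exact: Gcomm.
Qed.

Theorem theorem4p2 (s : nat) (s_ge2 : (2 <= s)%N)
    (Sigma : set (config nat s -> config nat s)) :
  maximal_commutative Sigma ->
  maximal_commutative
    (generated_semigroup (two_sided Sigma `|` [set @shift_inv s])).
Proof.
move=> [SCAT _ Scomm Smax]; set G := _ `|` _.
have GCAT : G `<=` CAT (I := int) (s := s).
  move=> tau [[r [f [_ ->]]]|->]; first exact: CAT_of_block_map.
  exact: CAT_shift_inv.
have subG : G `<=` generated_semigroup G by exact: sub_gen_smallest.
have closedG : composition_closed (generated_semigroup G).
  by move=> tau mu Gtau Gmu A AG; apply: AG.1; [exact: Gtau|exact: Gmu].
split=> //.
- apply: smallest_sub => //; exact: CAT_comp.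
- apply: generated_semigroup_commute => tau mu Gtau Gmu.
  case: (Gtau) => [|->]; last by rewrite CAT_int_shift_inv //; exact: GCAT.
  case: Gmu => [|->]; last by move=> _; exact/CAT_int_shift_inv/GCAT.
  move=> [q [g [Sg ->]]] [r [f [Sf ->]]].
  exact/block_map_comm/Scomm.
- move=> mu muC mu_comm.
  have [m [r [f fE]]] := CAT_int_block_map muC.
  have Sf : Sigma (of_block_map f).
    apply: Smax; first exact: CAT_of_block_map.
    (* Commutation with [tau] is checked on two-sided sequences, where [f] induces the [m]-fold
       shift of [mu], and both [mu] and the shift commute with the map induced by [g]. *)
    move=> tau Stau; have [q [g tauE]] := CAT_nat_block_map (SCAT _ Stau).
    rewrite tauE in Stau *; apply/block_map_comm; rewrite -fE.
    have Gg : generated_semigroup G (of_block_map g).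
      by apply: subG; left; exists q, g.
    have /funeqP mu_g := mu_comm _ Gg.
    apply/funext => a /=; rewrite CAT_iter_shift; last exact: CAT_of_block_map.
    by move: (mu_g a) => /= ->.
  have -> : mu = iter m (@shift_inv s) \o of_block_map f.
    rewrite -fE; apply/funext => a /=; elim: m {fE} => //= m IHm.
    by rewrite -iterS iterSr shiftK.
  elim: m {fE} => [|m IHm]; first by apply: subG; left; exists r, f.
  by apply: closedG IHm; apply: subG; right.
Qed.
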